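(* Consider $(R,V)$ where $V$ is the convex hull of $\mathbb{Q}$. If $(R,V)$ has property $\ast$, then $(R,V)\models \Sigma (1)$.
   Context: $R$ is an o-minimal expansion of an ordered field in a language $\mathcal{L}_0$ with quantifier elimination (expanded by definitions); $V$ is a predicate for a proper convex subring of $R$ with maximal ideal $\mathfrak{m}$. For an o-minimal field $S$, $I_S=\{x\in S:0\le x\le 1\}$, $\overline{x}$ is the residue of $x\in V(S)$, and $X(a)=\{\underline{x}: (a,\underline{x})\in X\}$. $(S,V)\models\Sigma(1)$ means: for each $S$-definable $X\subseteq I_S^{2}$ there is $\epsilon_0\in\mathfrak{m}^{>0}$ with $\overline{X(\epsilon_0)}=\overline{X(\epsilon)}$ for all $\epsilon\in\mathfrak{m}^{>\epsilon_0}$; this is equivalent to o-minimality of the residue field with induced structure. Work in a monster model $\mathcal{R}$. A Morley sequence in a global $R$-invariant type $p$ over $R$ is $t_1,t_2,\dots$ with $t_1\models p|_R$, $t_{k+1}\models p|_{Rt_1\dots t_k}$; $A\perp_B D$ denotes forking (= dividing) independence. Property $\ast$: with $p$ the global type $V(R)<x<\mathcal{R}^{>V(R)}$, for every finite Morley sequence $t_1,\dots,t_n$ in $p$ over $R$, no function $\mathcal{L}_0$-definable over $Rt_2\dots t_{n-1}$ maps a cofinal sequence in $V(R)$ onto a coinitial sequence in the convex hull of $R^{>V(R)}$ in $\mathcal{R}$ (equivalently $t_1\perp_R t_2\dots t_n$). *)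

(* Defs.v *)
From HB Require Import structures.
From mathcomp Require Import all_boot all_order all_algebra.
From mathcomp Require Import boolp classical_sets.

Set Implicit Arguments.
Unset Strict Implicit.
Unset Printing Implicit Defensive.

Import Order.TTheory GRing.Theory Num.Theory.
Local Open Scope classical_set_scope.
Local Open Scope ring_scope.

(* Only the extra symbols are recorded: 0, 1, +, -, *, =, < are logical symbols
   of every language below. *)
Record language := Language {
  fsym : Type;
  farity : fsym -> nat;
  rsym : Type;
  rarity : rsym -> nat }.

Inductive term (L : language) : Type :=
| Var of nat
| Zero
| One
| Add of term L & term L
| Opp of term L
| Mul of term L & term L
| App (f : fsym L) of ('I_(farity f) -> term L).

(* De Bruijn indices: [Ex phi] binds the variable 0 of [phi]. *)
Inductive formula (L : language) : Type :=
| Eq of term L & term L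
| Lt of term L & term L
| Rel (r : rsym L) of ('I_(rarity r) -> term L)
| Not of formula L
| And of formula L & formula L
| Ex of formula L.

Arguments Var {L}.
Arguments Zero {L}.
Arguments One {L}.

(* An expansion of an ordered field: the symbols of the language of ordered
   rings are interpreted by the carrier. *)
Record structure (L : language) := Structure {
  carrier :> realFieldType;
  ifun : forall f : fsym L, ('I_(farity f) -> carrier) -> carrier;
  irel : forall r : rsym L, ('I_(rarity r) -> carrier) -> Prop }.

Section Semantics.
Variables (L : language) (M : structure L).

(* As in [GRing.eval], a variable beyond the end of [e] denotes 0. *)
Fixpoint eval (e : seq M) (t : term L) : M :=
  match t with
  | Var i => e`_i
  | Zero => 0
  | One => 1
  | Add t1 t2 => eval e t1 + eval e t2
  | Opp t1 => - eval e t1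
  | Mul t1 t2 => eval e t1 * eval e t2
  | App f args => ifun (fun i => eval e (args i))
  end.

Fixpoint sat (e : seq M) (phi : formula L) : Prop :=
  match phi with
  | Eq t1 t2 => eval e t1 = eval e t2
  | Lt t1 t2 => eval e t1 < eval e t2
  | Rel r args => irel (fun i => eval e (args i))
  | Not phi1 => ~ sat e phi1
  | And phi1 phi2 => sat e phi1 /\ sat e phi2
  | Ex phi1 => exists x : M, sat (x :: e) phi1
  end.

Definition definable (A : set M) (k : nat) (X : set (k.-tuple M)) : Prop :=
  exists (phi : formula L) (s : seq M),
    [set` s] `<=` A /\ X = [set x : k.-tuple M | sat (x ++ s) phi].

Definition definable_fun (A : set M) (f : M -> M) : Prop :=
  definable A [set x : 2.-tuple M | f (tnth x 0) = tnth x 1].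

Definition o_minimal : Prop :=
  forall X : set M, definable setT [set x : 1.-tuple M | X (tnth x 0)] ->
  exists I : seq (interval M), X = \bigcup_(i in [set` I]) [set` i].

Fixpoint quantifier_free (phi : formula L) : Prop :=
  match phi with
  | Not phi1 => quantifier_free phi1
  | And phi1 phi2 => quantifier_free phi1 /\ quantifier_free phi2
  | Ex _ => False
  | _ => True
  end.

(* Quantifier elimination for the complete theory of [M]. *)
Definition has_QE : Prop :=
  forall phi : formula L, exists2 psi : formula L,
    quantifier_free psi & forall e : seq M, sat e phi <-> sat e psi.

(* The pair [(phi, s)] stands for the formula phi(x, s) with parameters [s];
   the variable x of the type has index 0. *)
Definition ptype := set (formula L * seq M).

Definition over (A : set M) (q : ptype) : Prop :=
  forall c, q c -> [set` c.2] `<=` A.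

Definition realizes (q : ptype) (x : M) : Prop :=
  forall c, q c -> sat (x :: c.2) c.1.

Definition fin_sat (q : ptype) : Prop :=
  forall (n : nat) (F : 'I_n -> formula L * seq M), (forall i, q (F i)) ->
  exists x : M, forall i, sat (x :: (F i).2) (F i).1.

(* Global means: over the whole of [M]. *)
Definition global_type (p : ptype) : Prop :=
  fin_sat p /\ forall phi s, p (phi, s) \/ p (Not phi, s).

Definition restrict_type (p : ptype) (A : set M) : ptype :=
  [set c | p c /\ [set` c.2] `<=` A].

(* [t = t_1, ..., t_n] with t_(k+1) realizing p|(B t_1 ... t_k) for all k. *)
Definition Morley_seq (p : ptype) (B : set M) (t : seq M) : Prop :=
  forall k, (k < size t)%N ->
    realizes (restrict_type p (B `|` [set` take k t])) t`_k.

End Semantics.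

Definition elementary (L : language) (M N : structure L) (j : M -> N) : Prop :=
  forall (phi : formula L) (e : seq M), sat e phi <-> sat (map j e) phi.

(* Small sets and tuples are those indexed by [K]. *)
Definition saturated (L : language) (K : Type) (N : structure L) : Prop :=
  forall (a : K -> N) (q : ptype N),
    over (range a) q -> fin_sat q -> exists x : N, realizes q x.

(* A bijective elementary self-map is the same thing as an automorphism. *)
Definition strongly_homogeneous (L : language) (K : Type)
    (N : structure L) : Prop :=
  forall a b : K -> N,
    (forall (phi : formula L) (s : seq K),
       sat (map a s) phi <-> sat (map b s) phi) ->
  exists sigma : N -> N,
    [/\ bijective sigma, elementary sigma & forall k, sigma (a k) = b k].

(* [N] is a monster model around [M], which is embedded by [j]: sets of
   cardinality at most |M| + |L| are small. *)
Definition monster (L : language) (M N : structure L) (j : M -> N) : Prop :=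
  [/\ elementary j,
      saturated (M + (fsym L + rsym L))%type N &
      strongly_homogeneous (M + (fsym L + rsym L))%type N].

Section Convex.
Variable F : realFieldType.

Definition convex_hull (A : set F) : set F :=
  [set x | exists a b, [/\ A a, A b & a <= x <= b]].

Definition above (A : set F) : set F := [set x | forall a, A a -> a < x].

Definition proper_convex_subring (V : set F) : Prop :=
  [/\ GRing.subring_closed (mem V),
      forall x y z, V x -> V y -> x <= z <= y -> V z &
      V != setT].

(* [V] is a local ring, with maximal ideal the set of its nonunits. *)
Definition max_ideal (V : set F) : set F :=
  [set x | V x /\ ~ exists2 y, V y & x * y = 1].

(* The residue of [x], as a coset of the maximal ideal. *)
Definition residue (V : set F) (x : F) : set F :=
  [set x + e | e in max_ideal V].

Definition unit_square : set (2.-tuple F) :=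
  [set x | forall i, 0 <= tnth x i <= 1].

Definition fiber (X : set (2.-tuple F)) (a : F) : set F :=
  [set x | X [tuple a; x]].

End Convex.

Definition Sigma1 (L : language) (S : structure L) (V : set S) : Prop :=
  forall X : set (2.-tuple S), definable setT X -> X `<=` @unit_square S ->
  exists eps0 : S, [/\ max_ideal V eps0, 0 < eps0 &
    forall eps : S, max_ideal V eps -> eps0 < eps ->
      residue V @` fiber X eps0 = residue V @` fiber X eps].

Section PropertyStar.
Variables (L : language) (R : structure L) (V : set R).
Variables (RR : structure L) (j : R -> RR).

(* [p] is the global type V(R) < x < RR^{>V(R)}. *)
Definition cut_type (p : ptype RR) : Prop :=
  [/\ global_type p,
      forall v, V v -> p (Lt (Var 1) (Var 0), [:: j v]) &
      forall w, above (j @` V) w -> p (Lt (Var 0) (Var 1), [:: w])].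

(* Sequences are indexed by well-orders; as usual a cofinal sequence is
   increasing and a coinitial one decreasing.  Monotonicity matters: if c > V,
   the function equal to 1/x on ]0, 1[ and to c elsewhere always maps the
   cofinal subset of V consisting of the positive infinitesimals and the
   natural numbers onto a coinitial subset of R^{>V}. *)
Definition maps_cofinal_to_coinitial (f : RR -> RR) (A : set R)
    (B : set RR) : Prop :=
  exists (d : Order.disp_t) (I : orderType d) (a : I -> R),
    [/\ well_founded (fun i k : I => (i < k)%O),
        [/\ forall i, A (a i),
            forall i k, (i < k)%O -> a i < a k &
            forall x, A x -> exists i, x <= a i] &
        [/\ forall i, B (f (j (a i))),
            forall i k, (i < k)%O -> f (j (a k)) < f (j (a i)) &
            forall y, B y -> exists i, f (j (a i)) <= y]].

(* For t = t_1, ..., t_n, [behead (take (size t).-1 t)] is t_2, ..., t_(n-1). *)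
Definition property_star (p : ptype RR) : Prop :=
  forall t : seq RR, Morley_seq p (range j) t ->
  ~ exists f : RR -> RR,
      definable_fun (range j `|` [set` behead (take (size t).-1 t)]) f /\
      maps_cofinal_to_coinitial f V (convex_hull (j @` above V)).

End PropertyStar.

(* Main.v *)
(** For each [n] the set of cells [[i/n, (i+1)/n]] met by [X(e)] takes finitely
    many values, so by o-minimality it is constant for [e] in some interval from
    an infinitesimal to a non-infinitesimal. In the monster model let [t] realize
    the cut above [V], so that [1/t] lies between the infinitesimals and the
    non-infinitesimals, and let [g(a)] be the infimum of the [u] such that any two
    fibers over [(u, 1/t]] are [1/a]-close. Then [1/g] is definable over [R t], and
    it maps the integers, which are cofinal in [V], into the convex hull of
    [R^{>V}]. By property * (applied to a Morley sequence [t1, t, t3]) the image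
    is not coinitial, which yields a single infinitesimal beyond which all fibers
    over infinitesimals are [1/n]-close for every [n]. Overspill across the cut
    turns this into equality of the residues. *)

Require Import Defs.
From mathcomp Require Import all_boot all_order all_algebra.
From mathcomp Require Import boolp classical_sets.
From mathcomp Require Import ring lra.
Local Open Scope classical_set_scope.
Local Open Scope ring_scope.

Set Implicit Arguments.
Unset Strict Implicit.
Unset Printing Implicit Defensive.

Import Order.TTheory GRing.Theory Num.Theory.

(** * Renaming of variables and derived connectives *)

Section Syntax.
Variable L : language.

Fixpoint rename_term (r : nat -> nat) (t : term L) : term L :=
  match t with
  | Var i => Var (r i)
  | Zero => Zero
  | One => One
  | Add t1 t2 => Add (rename_term r t1) (rename_term r t2)
  | Opp t1 => Opp (rename_term r t1)
  | Mul t1 t2 => Mul (rename_term r t1) (rename_term r t2)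
  | App f args => App (fun i => rename_term r (args i))
  end.

Definition lift_renaming (r : nat -> nat) (i : nat) : nat :=
  if i is i'.+1 then (r i').+1 else 0%N.

Fixpoint rename (r : nat -> nat) (phi : formula L) : formula L :=
  match phi with
  | Eq t1 t2 => Eq (rename_term r t1) (rename_term r t2)
  | Lt t1 t2 => Lt (rename_term r t1) (rename_term r t2)
  | Rel s args => Rel (fun i => rename_term r (args i))
  | Not phi1 => Not (rename r phi1)
  | And phi1 phi2 => And (rename r phi1) (rename r phi2)
  | Ex phi1 => Ex (rename (lift_renaming r) phi1)
  end.

Definition Imp (phi psi : formula L) := Not (And phi (Not psi)).
Definition Iff (phi psi : formula L) := And (Imp phi psi) (Imp psi phi).
Definition All (phi : formula L) := Not (Ex (Not phi)).
Definition Le (t u : term L) := Not (Lt u t).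

(* The formula [phi] read in the environment made of the variables listed in
   [l], followed by all the variables from [d] on. *)
Definition select (l : seq nat) (d : nat) : formula L -> formula L :=
  rename (fun m => if (m < size l)%N then nth 0%N l m else (d + (m - size l))%N).

Variable M : structure L.
Implicit Type e : seq M.

(** Environments are compared through [nth] alone, so they may differ in length: a variable past the
    end denotes 0. *)
Lemma eval_rename r e e' t : (forall i, e'`_i = e`_(r i)) ->
  eval e (rename_term r t) = eval e' t.
Proof.
move=> ee'; elim: t => //= [t1 -> t2 -> //|t1 -> //|t1 -> t2 -> //|f args IH].
by congr (ifun _); apply: funext => i; rewrite IH.
Qed.

Lemma sat_rename r e e' phi : (forall i, e'`_i = e`_(r i)) ->
  sat e (rename r phi) = sat e' phi.
Proof.
elim: phi r e e' => /=
  [t1 t2|t1 t2|s args|phi IH|phi IH1 psi IH2|phi IH] r e e' ee'.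
- by rewrite !(eval_rename _ ee').
- by rewrite !(eval_rename _ ee').
- by congr (irel _); apply: funext => i; rewrite (eval_rename _ ee').
- by rewrite (IH _ _ _ ee').
- by rewrite (IH1 _ _ _ ee') (IH2 _ _ _ ee').
- by apply: eq_exists => x; apply: IH => -[].
Qed.

Lemma nth_iter_behead d e i : (iter d behead e)`_i = e`_(d + i).
Proof. by elim: d i => // d IH i; rewrite iterS nth_behead IH addnS. Qed.

Lemma sat_select l d e phi :
  sat e (select l d phi) = sat ([seq e`_i | i <- l] ++ iter d behead e) phi.
Proof.
apply: sat_rename => i; rewrite nth_cat size_map; case: ltnP => il.
  by rewrite (nth_map 0%N).
by rewrite nth_iter_behead.
Qed.

Lemma sat_Imp e phi psi : sat e (Imp phi psi) = (sat e phi -> sat e psi).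
Proof.
rewrite /Imp /=; apply: propext; split=> [H h|H [h]]; last by apply; apply: H.
by apply: contrapT => nh; apply: H.
Qed.

Lemma sat_And e phi psi : sat e (And phi psi) = (sat e phi /\ sat e psi).
Proof. by []. Qed.

Lemma sat_Ex e phi : sat e (Ex phi) = exists x, sat (x :: e) phi.
Proof. by []. Qed.

Lemma sat_Iff e phi psi : sat e (Iff phi psi) = (sat e phi <-> sat e psi).
Proof. by rewrite sat_And !sat_Imp. Qed.

Lemma sat_All e phi : sat e (All phi) = forall x, sat (x :: e) phi.
Proof.
rewrite /All /=; apply: propext; split=> [H x|H [x]]; last by apply.
by apply: contrapT => nx; apply: H; exists x.
Qed.

Lemma sat_Le e t u : sat e (Le t u) = (eval e t <= eval e u) :> Prop.
Proof. by rewrite /Le /= leNgt; apply: propext; split=> /negP. Qed.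

End Syntax.

(** * Closeness of fibers as a first-order condition *)

Section Approximation.
Variables (L : language) (phi : formula L).

Section Semantics.
Variable M : structure L.
Implicit Types (c : seq M) (x a u t g : M).

Definition within a (y z : M) : Prop := a * (y - z) < 1 /\ a * (z - y) < 1.

(** One half of a Hausdorff distance condition on the fibers over [x] and [x']; exchanging them
    gives the other half. *)
Definition approx c a x x' : Prop :=
  forall y, sat [:: x, y & c] phi ->
  exists y', sat [:: x', y' & c] phi /\ within a y y'.

(** For [t > 0] the condition [x * t <= 1] means that x is at most 1/t. When [e0 > 0], the bound
    [e0 <= u] keeps the infimum over [u] positive, hence invertible. *)
Definition stable c e0 t a u : Prop :=
  e0 <= u /\ forall x x', u < x -> u < x' -> x * t <= 1 -> x' * t <= 1 ->
    approx c a x x'.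

Definition is_glb (S : set M) g : Prop :=
  forall y, y <= g <-> forall s, S s -> y <= s.

End Semantics.

(* The environments of the formulas below end with [c] and begin with
   [x', x, a] for [approxF], [u, a, t, e0] for [stableF], [g, a, t, e0] for
   [glbF], [a, b, t, e0] for [inv_glbF], [e0] for [has_glbF], [d, y, x] for
   [distF] and [x, i, a] for [cellF]. *)
Definition approxF : formula L :=
  All (Imp (select [:: 2; 0] 4 phi)
    (Ex (And (select [:: 2; 0] 5 phi)
      (And (Lt (Mul (Var 4) (Add (Var 1) (Opp (Var 0)))) One)
           (Lt (Mul (Var 4) (Add (Var 0) (Opp (Var 1)))) One))))).

Definition stableF : formula L :=
  And (Le (Var 3) (Var 0))
    (All (All (Imp (Lt (Var 2) (Var 1)) (Imp (Lt (Var 2) (Var 0))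
      (Imp (Le (Mul (Var 1) (Var 4)) One) (Imp (Le (Mul (Var 0) (Var 4)) One)
        (select [:: 0; 1; 3] 6 approxF))))))).

Definition glbF : formula L :=
  All (Iff (Le (Var 0) (Var 1))
    (All (Imp (select [:: 0; 3; 4; 5] 6 stableF) (Le (Var 1) (Var 0))))).

Definition inv_glbF : formula L :=
  Ex (And (Eq (Mul (Var 0) (Var 2)) One) (select [:: 0; 1; 3; 4] 5 glbF)).

Definition has_glbF : formula L := All (All (Imp (Lt Zero (Var 1)) (Ex glbF))).

Definition distF : formula L :=
  Ex (And (select [:: 3; 0] 4 phi)
    (And (Lt (Add (Var 2) (Opp (Var 0))) (Var 1))
         (Lt (Add (Var 0) (Opp (Var 2))) (Var 1)))).

Definition cellF : formula L :=
  Ex (And (select [:: 1; 0] 4 phi)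
    (And (Le (Var 2) (Mul (Var 3) (Var 0)))
         (Lt (Mul (Var 3) (Var 0)) (Add (Var 2) One)))).

Variable M : structure L.
Implicit Types (c : seq M) (x a u t g : M).

Lemma sat_approxF c a x x' : sat [:: x', x, a & c] approxF = approx c a x x'.
Proof.
rewrite sat_All; apply: eq_forall => y; rewrite sat_Imp sat_select.
congr (_ -> _); rewrite sat_Ex; apply: eq_exists => y'.
by rewrite sat_And sat_select.
Qed.

Lemma sat_stableF c e0 t a u :
  sat [:: u, a, t, e0 & c] stableF = stable c e0 t a u.
Proof.
rewrite sat_And sat_Le sat_All; congr (_ /\ _).
apply: eq_forall => x; rewrite sat_All; apply: eq_forall => x'.
by rewrite !sat_Imp !sat_Le sat_select -sat_approxF.
Qed.

Lemma sat_glbF c e0 t a g :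
  sat [:: g, a, t, e0 & c] glbF = is_glb (stable c e0 t a) g.
Proof.
rewrite sat_All; apply: eq_forall => y; rewrite sat_Iff sat_Le sat_All.
congr (_ <-> _); apply: eq_forall => s.
by rewrite sat_Imp sat_Le sat_select -sat_stableF.
Qed.

Lemma sat_inv_glbF c e0 t a b : sat [:: a, b, t, e0 & c] inv_glbF =
  exists g, g * b = 1 /\ is_glb (stable c e0 t a) g.
Proof.
rewrite sat_Ex; apply: eq_exists => g.
by rewrite sat_And sat_select -sat_glbF.
Qed.

Lemma sat_has_glbF c e0 : sat [:: e0 & c] has_glbF =
  forall t a, 0 < t -> exists g, is_glb (stable c e0 t a) g.
Proof.
rewrite sat_All; apply: eq_forall => t; rewrite sat_All; apply: eq_forall => a.
rewrite sat_Imp sat_Ex; congr (_ -> _); apply: eq_exists => g.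
by rewrite sat_glbF.
Qed.

Lemma sat_distF c x y d : sat [:: d, y, x & c] distF =
  exists y', sat [:: x, y' & c] phi /\ (y - y' < d /\ y' - y < d).
Proof. by rewrite sat_Ex; apply: eq_exists => y'; rewrite sat_And sat_select. Qed.

Lemma sat_cellF c x a i : sat [:: x, i, a & c] cellF =
  exists y, sat [:: x, y & c] phi /\ (i <= a * y /\ a * y < i + 1).
Proof.
by rewrite sat_Ex; apply: eq_exists => y; rewrite !sat_And sat_Le sat_select.
Qed.

Lemma is_glb_unique (S : set M) g g' : is_glb S g -> is_glb S g' -> g = g'.
Proof.
move=> Sg Sg'; apply: le_anti; apply/andP; split.
  by apply/Sg'/Sg.
by apply/Sg/Sg'.
Qed.

Lemma stable_up c e0 t a u v : stable c e0 t a u -> u <= v -> stable c e0 t a v.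
Proof.
move=> [eu H] uv; split=> [|x x' vx vx']; first exact: le_trans uv.
by apply: H; apply: le_lt_trans uv _.
Qed.

Lemma stable_mono c e0 t a b u : 0 <= a -> a <= b ->
  stable c e0 t b u -> stable c e0 t a u.
Proof.
move=> a0 ab [eu H]; split=> // x x' ux ux' xt xt' y Xy.
have [y' [Xy' [h1 h2]]] := H x x' ux ux' xt xt' y Xy.
exists y'; split=> //.
(* The product with the nonpositive difference is at most 0; the other one is bounded by the
   hypothesis for [b]. *)
have [yy'|yy'] := leP y y'.
  split; first by apply: (le_lt_trans _ ltr01); rewrite mulr_ge0_le0 ?subr_le0.
  by apply: (le_lt_trans _ h2); rewrite ler_wpM2r ?subr_ge0.
split; last by apply: (le_lt_trans _ ltr01); rewrite mulr_ge0_le0 ?subr_le0// ltW.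
by apply: (le_lt_trans _ h1); rewrite ler_wpM2r// subr_ge0 ltW.
Qed.

End Approximation.

(** * Infinitesimals and the cut just above them *)

Section Ordered.
Variable F : realFieldType.
Implicit Types (x y e : F) (P Q : set F).

Definition infinitesimal x : Prop := forall n : nat, `|x| * n%:R < 1.

Definition finite_hull : set F := convex_hull (range (ratr : rat -> F)).

Lemma finite_hullP x : finite_hull x <-> exists n : nat, `|x| <= n%:R.
Proof.
split=> [[_ [_ [[q _ <-] [r _ <-] /andP[qx xr]]]]|[n xn]].
  have bnd (s : rat) : exists n : nat, ratr s <= n%:R :> F.
    exists (Num.bound `|s|); rewrite -(ratr_nat F) ler_rat.
    by rewrite (le_trans (ler_norm s))// ltW// archi_boundP.
  have [[m qm] [n rn]] := (bnd (- q), bnd r).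
  exists (m + n)%N; rewrite natrD; rewrite rmorphN /= in qm.
  have := ler0n F m; have := ler0n F n; rewrite ler_norml; lra.
exists (ratr (- n%:R)), (ratr n%:R); split; [by exists (- n%:R)|by exists n%:R|].
by rewrite rmorphN /= ratr_nat -ler_norml.
Qed.

Lemma infinitesimalP x : max_ideal finite_hull x <-> infinitesimal x.
Proof.
split=> [[Vx Nx] n|Ix].
  rewrite ltNge; apply/negP => xn; apply: Nx.
  have x0 : x != 0.
    by apply: contraTN xn => /eqP ->; rewrite normr0 mul0r ler10.
  exists x^-1; last by rewrite mulfV.
  apply/finite_hullP; exists n; rewrite normfV.
  by rewrite -[_^-1]mulr1 ler_pdivrMl ?normr_gt0.
split; first by apply/finite_hullP; exists 1%N; have := Ix 1%N; rewrite mulr1 => /ltW.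
move=> [y /finite_hullP[n yn] xy]; have := Ix n; rewrite ltNge => /negP; apply.
have : `|x * y| <= `|x| * n%:R by rewrite normrM ler_wpM2l.
by rewrite xy normr1.
Qed.

Lemma infinitesimalD x y : infinitesimal x -> infinitesimal y -> infinitesimal (x + y).
Proof.
move=> Ix Iy n; have := Ix (n + n)%N; have := Iy (n + n)%N; rewrite natrD.
have : `|x + y| * n%:R <= (`|x| + `|y|) * n%:R by rewrite ler_wpM2r ?ler_normD.
rewrite !mulrDr mulrDl; lra.
Qed.

Lemma infinitesimalN x : infinitesimal x -> infinitesimal (- x).
Proof. by move=> Ix n; rewrite normrN. Qed.

Lemma infinitesimal_max x y : infinitesimal x -> infinitesimal y -> infinitesimal (Num.max x y).
Proof. by move=> Ix Iy; case: (leP x y). Qed.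

Lemma infinitesimal_le x y : `|x| <= y -> infinitesimal y -> infinitesimal x.
Proof.
move=> xy Iy n; apply: le_lt_trans (Iy n).
by rewrite ler_wpM2r// (le_trans xy)// ler_norm.
Qed.

Lemma above_finite_hull w : above finite_hull w -> 0 < w /\ infinitesimal w^-1.
Proof.
move=> aw.
have wn (n : nat) : n%:R < w.
  by apply: aw; apply/finite_hullP; exists n; rewrite normr_nat.
have w0 : 0 < w := wn 0%N.
by split=> // n; rewrite gtr0_norm ?invr_gt0// mulrC ltr_pdivrMr// mul1r.
Qed.

Lemma inv_infinitesimal_above e : 0 < e -> infinitesimal e -> above finite_hull e^-1.
Proof.
move=> e0 Ie x /finite_hullP[n xn]; rewrite -[e^-1]mulr1 ltr_pdivlMl//.
apply: le_lt_trans (Ie n); rewrite gtr0_norm// ler_pM2l//.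
exact: le_trans (ler_norm x) xn.
Qed.

Lemma residue_eq x y : infinitesimal (x - y) ->
  residue finite_hull x = residue finite_hull y.
Proof.
move=> Ixy; apply/seteqP; split=> z [e /infinitesimalP Ie <-].
  exists (e + (x - y)); last by ring.
  exact/infinitesimalP/infinitesimalD.
exists (e - (x - y)); last by ring.
exact/infinitesimalP/infinitesimalD/infinitesimalN.
Qed.

(* The filter of neighbourhoods of the cut between the infinitesimals and the
   positive non-infinitesimals. *)
Definition ev P : Prop := exists e (n : nat), [/\ infinitesimal e, 0 < e &
  forall x, e < x -> x * n%:R <= 1 -> P x].

Lemma evI P Q : ev P -> ev Q -> ev (P `&` Q).
Proof.
move=> [e [n [Ie e0 He]]] [d [m [Id d0 Hd]]].
exists (Num.max e d), (maxn n m); split; first exact: infinitesimal_max.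
  by rewrite lt_max e0.
move=> x; rewrite gt_max => /andP[ex dx] xnm.
have x0 : 0 <= x by rewrite ltW// (lt_trans e0).
by split; [apply: He|apply: Hd] => //; apply: le_trans xnm;
  rewrite ler_wpM2l// ler_nat ?leq_maxl ?leq_maxr.
Qed.

Lemma ev_sub P Q : P `<=` Q -> ev P -> ev Q.
Proof.
by move=> PQ [e [n [Ie e0 He]]]; exists e, n; split=> // x ex xn; apply/PQ/He.
Qed.

(** Half of overspill: a neighbourhood of the cut has elements on both sides, here an infinitesimal
    one, in [ev_standard] one of the form 1/(n+1). *)
Lemma ev_infinitesimal P : ev P -> exists x, [/\ infinitesimal x, 0 < x & P x].
Proof.
move=> [e [n [Ie e0 He]]]; have Iee := infinitesimalD Ie Ie.
exists (e + e); split=> //; first by rewrite addr_gt0.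
apply: He; first by rewrite ltrDl.
by have := Iee n; rewrite gtr0_norm ?addr_gt0// => /ltW.
Qed.

Lemma ev_standard P : ev P -> exists n : nat, P (n.+1%:R)^-1.
Proof.
move=> [e [n [Ie e0 He]]]; exists n; apply: He.
  have := Ie n.+1; rewrite gtr0_norm//.
  by rewrite -ltr_pdivlMr ?ltr0Sn// mul1r.
by rewrite mulrC ler_pdivrMr ?ltr0Sn// mul1r ler_nat.
Qed.

(** On such sets the filter [ev] behaves like an ultrafilter. *)
Definition decided P : Prop := ev P \/ ev (~` P).

Lemma decidedC P : decided P -> decided (~` P).
Proof. by move=> [?|?]; [right; rewrite setCK|left]. Qed.

Lemma decidedI P Q : decided P -> decided Q -> decided (P `&` Q).
Proof.
move=> [eP|eP] [eQ|eQ]; first by left; apply: evI.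
- by right; apply: ev_sub eQ => x nQ [].
- by right; apply: ev_sub eP => x nP [].
- by right; apply: ev_sub eP => x nP [].
Qed.

Lemma decidedU P Q : decided P -> decided Q -> decided (P `|` Q).
Proof.
move=> dP dQ; rewrite -[P `|` Q]setCK setCU.
by apply/decidedC/decidedI; apply: decidedC.
Qed.

Variable e0 : F.
Hypotheses (e0_gt0 : 0 < e0) (e0_inf : infinitesimal e0).

Lemma evT : ev setT.
Proof. by exists e0, 0%N. Qed.

(** No element fills the cut: an infinitesimal or nonpositive [a] lies below it, any other [a]
    above. *)
Lemma ev_lt_or_gt a : ev [set x | a < x] \/ ev [set x | x < a].
Proof.
have [Ia|/existsNP[n /negP]] := pselect (infinitesimal a).
  left; exists (Num.max e0 `|a|), 0%N; split.
  - by apply: infinitesimal_max => // n; rewrite normr_id.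
  - by rewrite lt_max e0_gt0.
  - by move=> x; rewrite gt_max => /andP[_ ax] _; rewrite /= (le_lt_trans (ler_norm a)).
rewrite -leNgt; have [a0|a0] := leP a 0 => an.
  by left; exists e0, 0%N; split=> // x ex _ /=; rewrite (le_lt_trans a0)// (lt_trans e0_gt0).
(* [n.+1] gives strictness: x (n+1) <= 1 <= a n < a (n+1). *)
right; exists e0, n.+1; split=> // x ex xn /=.
rewrite gtr0_norm// in an; rewrite -(ltr_pM2r (ltr0Sn F n)).
by apply: le_lt_trans xn (le_lt_trans an _); rewrite ltr_pM2l// ltr_nat.
Qed.

Lemma decided_itv (i : interval F) : decided [set` i].
Proof.
have dgt a : decided [set x | a < x].
  have [e|e] := ev_lt_or_gt a; first by left.
  by right; apply: ev_sub e => x /=; case: ltgtP.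
have dlt a : decided [set x | x < a].
  have [e|e] := ev_lt_or_gt a; last by left.
  by right; apply: ev_sub e => x /=; case: ltgtP.
have dge a : decided [set x | a <= x].
  have := decidedC (dlt a); congr decided; apply/seteqP.
  by split=> x /=; case: leP.
have dle a : decided [set x | x <= a].
  have := decidedC (dgt a); congr decided; apply/seteqP.
  by split=> x /=; case: leP.
have dT : decided setT by left; exact: evT.
have dF : decided set0 by right; rewrite setC0; exact: evT.
case: i => l r.
(* Each end contributes a half-line; an infinite end gives [setT] or, on the wrong side, [set0]. *)
suff -> : [set` Interval l r] =
  (match l with BSide true a => [set x | a <= x] | BSide false a => [set x | a < x]
    | BInfty b => if b then setT else set0 end) `&`
  (match r with BSide true a => [set x | x < a] | BSide false a => [set x | x <= a]
    | BInfty b => if b then set0 else setT end).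
  by apply: decidedI; case: l r => [[] a|[]] [[] b|[]].
apply/seteqP; split=> x /=; rewrite in_itv.
  by move=> /andP[]; case: l r => [[] a|[]] [[] b|[]].
by move=> [xl xr]; apply/andP; case: l r xl xr => [[] a|[]] [[] b|[]].
Qed.

Lemma decided_bigcup (I : seq (interval F)) :
  decided (\bigcup_(i in [set` I]) [set` i]).
Proof.
elim: I => [|i I IH].
  right; apply: ev_sub evT => x _ [] //.
suff -> : \bigcup_(k in [set` i :: I]) [set` k] =
    [set` i] `|` \bigcup_(k in [set` I]) [set` k].
  by apply: decidedU IH; apply: decided_itv.
apply/seteqP; split=> [x [k /=]|x [xi|[k kI xk]]].
- by rewrite inE => /orP[/eqP -> ?|kI xk]; [left|right; exists k].
- by exists i => //=; rewrite inE eqxx.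
- by exists k => //=; rewrite inE kI orbT.
Qed.

(** Membership in one decided set is constant near the cut, and finitely many neighbourhoods can be
    intersected. *)
Lemma ev_decided_family (P : nat -> set F) : (forall i, decided (P i)) ->
  forall N, ev [set x | forall i, (i < N)%N -> (P i x <-> ev (P i))].
Proof.
move=> dP; elim=> [|N IH]; first by apply: ev_sub evT.
have eN : ev [set x | P N x <-> ev (P N)].
  have [e|e] := dP N; first by apply: ev_sub (e) => x Px; split.
  apply: ev_sub (e) => x nP; split=> // eP.
  by have [y [_ _ []]] := ev_infinitesimal (evI eP e).
apply: ev_sub (evI IH eN) => x [H HN] i; rewrite ltnS leq_eqVlt => /orP[/eqP -> //|].
exact: H.
Qed.

End Ordered.

(** * Infima of finite unions of intervals *)

Section Infimum.
Variable F : realFieldType.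
Implicit Types (S : set F).

Definition unbounded_below S : Prop := forall y, exists2 s, S s & s < y.

Lemma glb_itv (i : interval F) :
  [\/ [set` i] = set0, unbounded_below [set` i] | exists g, 
    forall y, y <= g <-> forall s, [set` i] s -> y <= s].
Proof.
have [i0|/existsNP[x /contrapT xi]] := pselect (forall x, ~ [set` i] x).
  by constructor 1; apply/seteqP; split.
case: i xi => [[b a|[]]] r /= xi; last by rewrite /= in_itv /= in xi.
  constructor 3; exists a => y; split=> [ya s|H].
    rewrite in_itv /= => /andP[+ _]; case: b {xi} => as_; rewrite (le_trans ya)//.
    exact: ltW.
  rewrite leNgt; apply/negP => ay.
  (* A lower bound [y] above the left end [a] would leave room for the midpoint, which lies in the
     interval by convexity. *)
  have yx := H x xi; pose z := (a + y) / 2.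
  have zy : z < y by rewrite /z; lra.
  have az : a < z by rewrite /z; lra.
  have zx : z < x by apply: lt_le_trans yx.
  suff zi : [set` Interval (BSide b a) r] z by have := H z zi; rewrite leNgt zy.
  move: xi; rewrite /= !in_itv /= => /andP[_ xr]; apply/andP; split.
    by case: b {H} => //; exact: ltW.
  by case: r xr {H} => [[] c|[]] //= xc; [apply: lt_trans xc|rewrite ltW// (lt_le_trans zx)].
constructor 2 => y; exists (Num.min x (y - 1)); last by rewrite gt_min; lra.
rewrite /= in_itv /=; move: xi; rewrite in_itv /=.
by case: r => [[] c|[]] //= xc; rewrite ?gt_min ?ge_min xc.
Qed.

Lemma glb_bigcup (I : seq (interval F)) :
  let S := \bigcup_(i in [set` I]) [set` i] in
  [\/ S = set0, unbounded_below S | exists g,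
    forall y, y <= g <-> forall s, S s -> y <= s].
Proof.
elim: I => [|i I] /=; first by constructor 1; apply/seteqP; split=> x // -[].
set S := \bigcup_(_ in _) _; set T := \bigcup_(_ in _) _ => IH.
have -> : T = [set` i] `|` S.
  apply/seteqP; split=> [x [k /=]|x [xi|[k kI xk]]].
  - by rewrite inE => /orP[/eqP -> ?|kI xk]; [left|right; exists k].
  - by exists i => //=; rewrite inE eqxx.
  - by exists k => //=; rewrite inE kI orbT.
case: IH => [->|SN|[g gP]].
- by rewrite setU0; exact: glb_itv.
- by constructor 2 => y; have [s Ss sy] := SN y; exists s => //; right.
case: (glb_itv i) => [->|iN|[h hP]].
- by rewrite set0U; constructor 3; exists g.
- by constructor 2 => y; have [s Ss sy] := iN y; exists s => //; left.
constructor 3; exists (Num.min h g) => y; rewrite le_min; split.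
  by move=> /andP[/hP yi /gP yS] s [/yi|/yS].
by move=> H; apply/andP; split; [apply/hP => s si|apply/gP => s si]; apply: H; [left|right].
Qed.

End Infimum.

(** * Consequences of o-minimality at the cut *)

Section OMinimal.
Variables (L : language) (R : structure L).
Hypothesis R_omin : o_minimal R.

Lemma o_minimal_sat (phi : formula L) (c : seq R) :
  exists I : seq (interval R),
    [set x | sat (x :: c) phi] = \bigcup_(i in [set` I]) [set` i].
Proof.
apply: R_omin; exists phi, c; split=> //; apply/seteqP.
by split=> x /=; have -> : x = [:: tnth x 0] :> seq R
  by case: x => -[|y []] //= i; rewrite (tnth_nth 0).
Qed.

(** The stable [u] form a finite union of intervals, nonempty because beyond 1/t the condition is
    vacuous, and bounded below by [e0]. *)
Lemma has_glb (phi : formula L) (c : seq R) e0 t a : 0 < t ->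
  exists g, is_glb (stable phi c e0 t a) g.
Proof.
move=> t0; have [I SI] := o_minimal_sat (stableF phi) [:: a, t, e0 & c].
have Sv u : stable phi c e0 t a u <-> (\bigcup_(i in [set` I]) [set` i]) u.
  by rewrite -SI -sat_stableF.
case: (glb_bigcup I) => [I0|IN|[g gP]].
- have : (set0 : set R) (Num.max e0 t^-1).
    rewrite -I0 -Sv; split; first by rewrite le_max lexx.
    move=> x x'; rewrite gt_max => /andP[_ +] _ xt _.
    by rewrite -[t^-1]mul1r ltr_pdivrMr// ltNge xt.
  by [].
- have [s /Sv[es _]] := IN e0; by rewrite ltNge es.
- by exists g => y; rewrite gP; split=> H s /Sv /H.
Qed.

Variable e0 : R.
Hypotheses (e0_gt0 : 0 < e0) (e0_inf : infinitesimal e0).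

Lemma decided_sat (phi : formula L) (c : seq R) : decided [set x | sat (x :: c) phi].
Proof. by have [I ->] := o_minimal_sat phi c; exact: decided_bigcup e0_gt0 e0_inf I. Qed.

(** Overspill: the [d] such that some point of the fiber is closer than [d] to [y] form a definable
    set. It contains every 1/(n+1), hence also an infinitesimal. *)
Lemma infinitesimally_close (phi : formula L) (c : seq R) x y :
  (forall n : nat, exists2 y', sat [:: x, y' & c] phi & within n%:R y y') ->
  exists2 y', sat [:: x, y' & c] phi & infinitesimal (y - y').
Proof.
move=> H; have [e|e] := decided_sat (distF phi) [:: y, x & c].
  have [d [Id d0 Sd]] := ev_infinitesimal e.
  have := Sd : sat [:: d, y, x & c] (distF phi).
  rewrite sat_distF => -[y' [Xy' [h1 h2]]].
  exists y' => //; apply: infinitesimal_le Id.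
  by rewrite ler_norml; apply/andP; split; lra.
have [n []] := ev_standard e.
rewrite -[_ _]/(sat [:: _, y, x & c] (distF phi)) sat_distF.
have [y' Xy' [h1 h2]] := H n.+1; exists y'; split=> //.
by split; rewrite -[_^-1]mulr1 ltr_pdivlMl ?ltr0Sn.
Qed.

(** [R] may be non-Archimedean, so the integer part is found by induction on a standard bound. *)
Lemma floor_below (z : R) (N : nat) : 0 <= z < N%:R ->
  exists2 i : nat, (i < N)%N & i%:R <= z < i%:R + 1.
Proof.
elim: N => [|N IH] /andP[z0 zN]; first by move: zN; rewrite ltNge z0.
have [zN'|Nz] := ltP z N%:R.
  have [|i iN iz] := IH; first by rewrite z0.
  by exists i => //; exact: ltnW.
by exists N => //; rewrite Nz -natr1 in zN *.
Qed.

(** Which cells of length 1/n the fiber meets is constant near the cut, and points of one cell are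
    less than 1/n apart. A natural number [N] stands in for [t], so that the statement lives in
    [R]. *)
Lemma stable_infinitesimal (phi : formula L) (c : seq R) (n : nat) :
  (forall x y, sat [:: x, y & c] phi -> 0 <= y <= 1) ->
  exists (N : nat) u, infinitesimal u /\ stable phi c e0 N%:R n%:R u.
Proof.
move=> X01.
pose P (i : nat) : set R := [set x | sat [:: x, i%:R, n%:R & c] (cellF phi)].
have [u [N [Iu u0 H]]] := ev_decided_family e0_gt0 e0_inf
  (fun i => decided_sat (cellF phi) [:: i%:R, n%:R & c] : decided (P i)) n.+1.
exists N, (Num.max u e0); split; first exact: infinitesimal_max.
split; first by rewrite le_max lexx orbT.
move=> x x'; rewrite !gt_max => /andP[ux _] /andP[ux' _] xN x'N y Xy.
have /andP[y0 y1] := X01 _ _ Xy.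
(* There are [n.+1] cells because y = 1 falls into the one of index [n]. *)
have [|i iN /andP[iy yi]] := @floor_below (n%:R * y) n.+1.
  by rewrite mulr_ge0//= -natr1 (@le_lt_trans _ _ n%:R) ?ltrDl// ler_piMr.
have : P i x by rewrite /P -[_ x]/(sat [:: x, _, _ & c] _) sat_cellF; exists y.
move/(H x ux xN i iN)/(H x' ux' x'N i iN); rewrite /P -[_ x']/(sat [:: x', _, _ & c] _) sat_cellF => -[y' [Xy' [iy' y'i]]].
by exists y'; split=> //; split; rewrite mulrBr; lra.
Qed.

End OMinimal.

(** * Order, integers and inverses under an elementary embedding *)

Section Elementary.
Variables (L : language) (M N : structure L) (j : M -> N).
Hypothesis j_elem : elementary j.

Lemma elementary_lt x y : (j x < j y) = (x < y).
Proof.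
have /= [h1 h2] := j_elem (Lt (Var 0) (Var 1)) [:: x; y].
by apply/idP/idP.
Qed.

Lemma elementary_le x y : (j x <= j y) = (x <= y).
Proof. by rewrite !leNgt elementary_lt. Qed.

Lemma elementary_nat n : j n%:R = n%:R.
Proof.
elim: n => [|n IH].
  by have /= [h _] := j_elem (Eq (Var 0) Zero) [:: 0]; apply: h.
have /= [h _] := j_elem (Eq (Var 0) (Add (Var 1) One)) [:: n%:R + 1; n%:R].
by rewrite -!natr1 -IH; apply: h.
Qed.

Lemma elementary_inv x : 0 < x -> j x^-1 = (j x)^-1.
Proof.
move=> x0; have jx0 : 0 < j x by rewrite -(elementary_nat 0 : j 0 = 0) elementary_lt.
apply: (mulIf (lt0r_neq0 jx0)); rewrite mulVf ?lt0r_neq0//.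
have /= [h _] := j_elem (Eq (Mul (Var 0) (Var 1)) One) [:: x^-1; x].
by apply: h; rewrite mulVf ?lt0r_neq0.
Qed.

End Elementary.

(** * Morley sequences from saturation *)

Section Saturation.

(* A field is infinite, so by Hilbert's hotel a family indexed by it has room
   for one more element. *)
Lemma enlarge_range (F : numDomainType) (T U : Type) (b : F + T -> U) (x : U) :
  exists b' : F + T -> U, range b `|` [set x] `<=` range b'.
Proof.
pose std (r : F) := exists n : nat, r = n%:R.
pose b' (k : F + T) := match k with
  | inl r => if `[< std r >] then if r == 0 then x else b (inl (r - 1)) else b k
  | inr _ => b k end.
have b'0 : b' (inl 0) = x by rewrite /b' eqxx asboolT//; exists 0%N.
exists b' => _ [[[r|k] _ <-]|->]; last by exists (inl 0).
  have [[n ->]|nr] := pselect (std r).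
    exists (inl n.+1%:R) => //; rewrite /b' asboolT; last by exists n.+1.
    by rewrite pnatr_eq0 /= -natr1 addrK.
  by exists (inl r) => //; rewrite /b' asboolF.
by exists (inr k).
Qed.

Variables (L : language) (T : Type) (R : realFieldType) (M : structure L).
Variables (j : R -> M) (p : ptype M).
Hypotheses (M_sat : saturated (R + T) M) (p_fin : fin_sat p).

(** Saturation speaks of parameters indexed by [R + T]; the elements of [l] are absorbed into such a
    family one at a time. *)
Lemma realizes_over (l : seq M) :
  exists x, realizes (restrict_type p (range j `|` [set` l])) x.
Proof.
have [b bP] : exists b : R + T -> M, range j `|` [set` l] `<=` range b.
  elim: l => [|x l [b bP]].
    exists (fun k => if k is inl r then j r else 0) => _ [[r _ <-]|//].
    by exists (inl r).
  have [b' b'P] := enlarge_range b x; exists b' => y [jy|/=].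
    by apply: b'P; left; apply: bP; left.
  rewrite inE => /orP[/eqP ->|yl]; first by apply: b'P; right.
  by apply: b'P; left; apply: bP; right.
apply: (M_sat (a := b)) => [c [_ cA]|n F pF]; first exact: subset_trans bP.
by apply: p_fin => i; have [] := pF i.
Qed.

(** With length three, the middle element is exactly the extra parameter that [property_star]
    allows. *)
Lemma Morley_seq3 : exists t1 t2 t3, Morley_seq p (range j) [:: t1; t2; t3].
Proof.
have [t1 h1] := realizes_over [::]; have [t2 h2] := realizes_over [:: t1].
have [t3 h3] := realizes_over [:: t1; t2].
by exists t1, t2, t3 => -[|[|[|]]].
Qed.

End Saturation.

(** As [B] has no least element, a strictly smaller value always occurs later; these jumps are
    iterated from 0. The bound [i <= k i] keeps the indices cofinal. *)
Lemma decreasing_subsequence (M : realFieldType) (B : set M) (h : nat -> M) :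
  (forall n, B (h n)) -> (forall m n, (m <= n)%N -> h n <= h m) ->
  (forall y, B y -> exists2 z, B z & z < y) ->
  (forall y, B y -> exists n, h n <= y) ->
  exists k : nat -> nat, [/\ forall i, (i <= k i)%N, {homo k : a b / (a < b)%N} &
    {homo h \o k : a b / (a < b)%N >-> b < a}].
Proof.
move=> hB h_mono B_nomin h_coinit.
have next n : exists m, (n < m)%N && (h m < h n).
  have [z Bz zn] := B_nomin _ (hB n); have [m mz] := h_coinit z Bz.
  have mn := le_lt_trans mz zn; exists m; rewrite mn andbT ltnNge.
  by apply/negP => /h_mono; rewrite leNgt mn.
pose s n := xchoose (next n); have sP n := xchooseP (next n).
pose k i := iter i s 0%N.
have k_lt i : (k i < k i.+1)%N by have /andP[] := sP (k i).
have hk_lt i : h (k i.+1) < h (k i) by have /andP[] := sP (k i).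
exists k; split.
- by elim=> // i IH; apply: leq_ltn_trans IH (k_lt i).
- exact: (homo_ltn ltn_trans k_lt).
- apply: (@homo_ltn _ (h \o k) (fun x y => y < x)) => // x y z xy yz.
  exact: lt_trans yz xy.
Qed.

(** An element outside the hull exceeds every integer in absolute value; the inverse of that
    absolute value is infinitesimal. *)
Lemma exists_infinitesimal (F : realFieldType) :
  proper_convex_subring (@finite_hull F) -> exists e : F, 0 < e /\ infinitesimal e.
Proof.
case=> _ _ /eqP VT.
have /existsNP[c Vc] : ~ forall c : F, finite_hull c.
  by move=> VF; apply: VT; apply/seteqP; split=> x _ //; exact: VF.
have cn (n : nat) : n%:R < `|c|.
  by rewrite ltNge; apply/negP => cn; apply: Vc; apply/finite_hullP; exists n.
have c0 : 0 < `|c| := cn 0%N.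
exists `|c|^-1; split; first by rewrite invr_gt0.
by move=> n; rewrite gtr0_norm ?invr_gt0// mulrC ltr_pdivrMr// mul1r.
Qed.

(** * The stability threshold in the monster model *)

Section Threshold.
Variables (L0 : language) (R : structure L0) (R_omin : o_minimal R).
Variables (RR : structure L0) (j : R -> RR) (j_elem : elementary j).
Variables (t : RR) (B : set RR).
Hypothesis t_gt : forall n : nat, n%:R < t.
Hypothesis B_E : B = convex_hull (j @` above (@finite_hull R)).
Variables (e0 : R) (e0_gt0 : 0 < e0) (e0_inf : infinitesimal e0).
Variables (phi : formula L0) (s : seq R).
Hypothesis phi01 : forall x y, sat [:: x, y & s] phi -> 0 <= y <= 1.

Let st (a u : RR) := stable phi (map j s) (j e0) t a u.

Let t_gt0 : 0 < t := t_gt 0.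

(** Existence of the infimum for all [t > 0] and [a] is a single formula in [e0] and [s], true in
    [R] by o-minimality and transferred by [j]. *)
Lemma has_glb_monster a : exists g, is_glb (st a) g.
Proof.
have := (j_elem (has_glbF phi) [:: e0 & s]).1.
by rewrite [map _ _]/= !sat_has_glbF; apply => // t' a' t'0; exact: has_glb.
Qed.

(** The function g of the outline. It is obtained by choice, but uniqueness of the infimum makes it
    definable. *)
Definition threshold a : RR := projT1 (cid (has_glb_monster a)).

Lemma thresholdP a : is_glb (st a) (threshold a).
Proof. by rewrite /threshold; case: cid. Qed.

Lemma threshold_ge a : j e0 <= threshold a.
Proof. by apply/thresholdP => u []. Qed.

Lemma je0_gt0 : 0 < j e0.
Proof. by rewrite -(elementary_nat j_elem 0 : j 0 = 0) elementary_lt. Qed.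

Lemma threshold_gt0 a : 0 < threshold a.
Proof. exact: lt_le_trans je0_gt0 (threshold_ge a). Qed.

Lemma definable_threshold_inv :
  definable_fun (range j `|` [set t]) (fun a => (threshold a)^-1).
Proof.
exists (inv_glbF phi), [:: t, j e0 & map j s]; split.
  move=> x /=; rewrite !inE => /or3P[/eqP ->|/eqP ->|/mapP[y _ ->]].
  - by right.
  - by left; exists e0.
  - by left; exists y.
apply/funext => x.
have xE : x = [:: tnth x 0; tnth x 1] :> seq RR.
  by case: x => -[|a [|b []]] //= i; rewrite !(tnth_nth 0).
rewrite -[RHS]/(sat (x ++ _) _) xE sat_inv_glbF /=; apply: propext; split.
  move=> <-; exists (threshold (tnth x 0)); split; last exact: thresholdP.
  by rewrite mulfV// lt0r_neq0// threshold_gt0.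
move=> [g [gb gP]]; rewrite (is_glb_unique (thresholdP _) gP).
have g0 : g != 0 by apply: contra_eq_neq gb => ->; rewrite mul0r eq_sym oner_neq0.
by rewrite -[g^-1]mulr1 -gb mulKf.
Qed.

(** Stability up to 1/N in [R] transfers to [RR]; since N < t, the range up to 1/t is smaller. *)
Lemma stable_standard (n : nat) : exists u, [/\ infinitesimal u, 0 < u & st n%:R (j u)].
Proof.
have [N [u [Iu Su]]] := stable_infinitesimal R_omin e0_gt0 e0_inf n phi01.
have eu : e0 <= u by case: Su.
exists u; split=> //; first exact: lt_le_trans eu.
have := (j_elem (stableF phi) [:: u, n%:R, N%:R, e0 & s]).1.
rewrite [map _ _]/= !sat_stableF => /(_ Su); rewrite !elementary_nat//.
move=> [_ H]; split; first by rewrite elementary_le.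
move=> x x' ux ux' xt xt'.
have le1 y : j u < y -> y * t <= 1 -> y * N%:R <= 1.
  move=> uy yt; apply: le_trans yt; rewrite ler_wpM2l ?ltW ?t_gt//.
  by rewrite (lt_trans _ uy)// (lt_le_trans je0_gt0)// elementary_le.
by apply: H => //; apply: le1.
Qed.

(** The threshold lies between [j e0] and [j u], and inverses of positive infinitesimals are above
    the finite hull. *)
Lemma threshold_inv_in (n : nat) : B (threshold n%:R)^-1.
Proof.
have [u [Iu u0 Su]] := stable_standard n.
have gu : threshold n%:R <= j u by have /(_ (threshold n%:R))[+ _] := thresholdP n%:R; apply.
rewrite B_E; exists (j u^-1), (j e0^-1); split.
- by exists u^-1 => //; apply: inv_infinitesimal_above.
- by exists e0^-1 => //; apply: inv_infinitesimal_above.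
- have ju0 : 0 < j u := lt_le_trans (threshold_gt0 _) gu.
  rewrite !elementary_inv// !lef_pV2 ?posrE ?threshold_gt0 ?je0_gt0 ?ju0//.
  by rewrite gu threshold_ge.
Qed.

Lemma threshold_mono (m n : nat) : (m <= n)%N ->
  (threshold n%:R)^-1 <= (threshold m%:R)^-1.
Proof.
move=> mn; rewrite lef_pV2 ?posrE ?threshold_gt0//.
apply/thresholdP => u Su; have /(_ (threshold m%:R))[+ _] := thresholdP m%:R.
apply=> //; apply: stable_mono Su => //; by rewrite ler_nat.
Qed.

(** Half of an element above the finite hull is still above it. *)
Lemma hull_no_min (y : RR) : B y -> exists2 z, B z & z < y.
Proof.
rewrite B_E => -[_ [b [[w aw <-] b_in /andP[wy yb]]]].
have [w0 Iw] := above_finite_hull aw.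
have Iw2 : infinitesimal (w / 2)^-1.
  rewrite invfM invrK mulrDr mulr1; exact: infinitesimalD.
have jw2 : j (w / 2) < j w by rewrite elementary_lt//; lra.
have aw2 : above (@finite_hull R) (w / 2).
  rewrite -[w / 2]invrK; apply: inv_infinitesimal_above => //.
  by rewrite invr_gt0 divr_gt0.
exists (j (w / 2)); last exact: lt_le_trans wy.
by exists (j (w / 2)), (j w); split; [exists (w / 2)|exists w|rewrite lexx ltW].
Qed.

Lemma maps_to_coinitial :
  (forall y, B y -> exists n : nat, (threshold n%:R)^-1 <= y) ->
  maps_cofinal_to_coinitial j (fun a => (threshold a)^-1) (@finite_hull R) B.
Proof.
move=> coinit.
have [k [k_ge k_lt hk]] := decreasing_subsequence
  (h := fun n : nat => (threshold n%:R)^-1) threshold_inv_in threshold_mono hull_no_min coinit.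
(* Since [i <= k i], the integers [k i] are cofinal in the finite hull. *)
exists _, nat, (fun i => (k i)%:R); split.
- move=> i; elim/ltn_ind: i => i IH; constructor => l li; apply: IH; exact: li.
- split=> [i|i l il|x /finite_hullP[n xn]].
  + by apply/finite_hullP; exists (k i); rewrite normr_nat.
  + by rewrite ltr_nat k_lt.
  + by exists n; rewrite (le_trans (ler_norm x))// (le_trans xn)// ler_nat.
- split=> [i|i l il|y By].
  + rewrite (elementary_nat j_elem); exact: threshold_inv_in.
  + by rewrite !(elementary_nat j_elem); apply: (hk i l il).
  + have [n ny] := coinit y By; exists n; rewrite (elementary_nat j_elem).
    by apply: le_trans ny; apply: threshold_mono.
Qed.

End Threshold.

(** * From the Morley sequence to a uniform infinitesimal bound *)

Theorem theorem5p6 (L0 : language) (R : structure L0)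
  (R_omin : o_minimal R) (R_QE : has_QE R)
  (V : set R) (V_ring : proper_convex_subring V)
  (V_hull : V = convex_hull (range (ratr : rat -> R)))
  (RR : structure L0) (j : R -> RR) (RR_monster : monster j)
  (p : ptype RR) (p_cut : cut_type V j p) :
  property_star V j p -> Sigma1 V.
Proof.
rewrite -/(@finite_hull R) in V_hull; subst V.
move=> star X [phi [s [_ XE]]] X01.
have XP x y : X [tuple x; y] <-> sat [:: x, y & s] phi by rewrite XE.
have phi01 x y : sat [:: x, y & s] phi -> 0 <= y <= 1.
  by move=> /XP /X01 /(_ 1); rewrite (tnth_nth 0).
case: RR_monster => j_elem RR_sat _; case: p_cut => -[p_fin _] p_gt p_lt.
have [t1 [t [t3 tM]]] := Morley_seq3 j RR_sat p_fin.
have tP := tM 1%N isT; rewrite /= in tP.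
have t_gt (n : nat) : n%:R < t.
  have Vn : finite_hull (n%:R : R) by apply/finite_hullP; exists n; rewrite normr_nat.
  rewrite -(elementary_nat j_elem); apply: (tP (Lt (Var 1) (Var 0), [:: j n%:R])).
  by split; [exact: p_gt|move=> y /=; rewrite inE => /eqP ->; left; exists n%:R].
have t_lt w : above (@finite_hull R) w -> t < j w.
  move=> aw; apply: (tP (Lt (Var 0) (Var 1), [:: j w])); split.
    by apply: p_lt => _ [v Vv <-]; rewrite elementary_lt//; exact: aw.
  by move=> y /=; rewrite inE => /eqP ->; left; exists w.
have [e0 [e0_gt0 e0_inf]] := exists_infinitesimal V_ring.
pose B := convex_hull (j @` above (@finite_hull R)).
pose g := threshold R_omin j_elem t_gt e0 phi s.
(* By [property_star] the values 1/g(n) are not coinitial in [B], so some [y] in [B] lies strictly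
   below all of them. *)
have /existsNP[y /not_implyP[By /forallNP gy]] :
    ~ forall y, B y -> exists n : nat, (g n%:R)^-1 <= y.
  move=> coinit; apply: (star _ tM); exists (fun a => (g a)^-1); split.
    have -> : [set` behead (take (size [:: t1; t; t3]).-1 [:: t1; t; t3])] = [set t].
      by apply/seteqP; split=> x /=; rewrite inE => /eqP.
    exact: definable_threshold_inv.
  by apply: maps_to_coinitial.
(* Here [y] is at least [j w] with [w] above [V]; the infinitesimal 1/w serves every [n] at once. *)
case: By => _ [_ [[w aw <-] _ /andP[wy _]]].
have [w0 Iw] := above_finite_hull aw.
have close (n : nat) x x' : infinitesimal x -> infinitesimal x' ->
    w^-1 < x -> w^-1 < x' -> approx phi s n%:R x x'.
  move=> Ix Ix' wx wx'.
  (* Otherwise [j w^-1] would be a lower bound of the stable elements, and 1/g(n) would be at most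
     [j w], hence at most [y]. *)
  have [u Su uw] : exists2 u, stable phi (map j s) (j e0) t n%:R u & u < j w^-1.
    apply: contrapT => nu; have : j w^-1 <= g n%:R.
      apply/thresholdP => u Su; rewrite leNgt; apply/negP => uw.
      by apply: nu; exists u.
    rewrite elementary_inv// => wg; apply: (gy n); apply: le_trans wy.
    rewrite -[X in _ <= X]invrK lef_pV2// posrE ?threshold_gt0// invr_gt0.
    by rewrite -(elementary_nat j_elem 0 : j 0 = 0) elementary_lt.
  have [_ H] := stable_up Su (ltW uw).
  (* For such [z] the inverse 1/z is above [V], so [t] lies below its image. *)
  have le1 z : infinitesimal z -> w^-1 < z -> j z * t <= 1.
    move=> Iz wz; have z0 : 0 < z by rewrite (lt_trans _ wz)// invr_gt0.
    have jz0 : 0 < j z by rewrite -(elementary_nat j_elem 0 : j 0 = 0) elementary_lt.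
    rewrite -ler_pdivlMl// mulr1 -elementary_inv// ltW//.
    exact/t_lt/inv_infinitesimal_above.
  have := (j_elem (approxF phi) [:: x', x, n%:R & s]).2.
  rewrite [map _ _]/= !sat_approxF (elementary_nat j_elem); apply.
  by apply: H; rewrite ?elementary_lt//; apply: le1.
have w'0 : 0 < w^-1 by rewrite invr_gt0.
have Iww := infinitesimalD Iw Iw.
(* Doubling puts the witness itself strictly above 1/w, so that [close] applies to its own fiber. *)
exists (w^-1 + w^-1); split; [exact/infinitesimalP|exact: addr_gt0|].
move=> x /infinitesimalP Ix wx.
have sub (z z' : R) : infinitesimal z -> infinitesimal z' -> w^-1 < z -> w^-1 < z' ->
    residue (@finite_hull R) @` fiber X z `<=` residue (@finite_hull R) @` fiber X z'.
  move=> Iz Iz' wz wz' _ [y0 /XP Xy0 <-].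
  have [n|y' Xy' Iy'] := infinitesimally_close R_omin e0_gt0 e0_inf (phi := phi)
    (c := s) (x := z') (y := y0).
    by have [y' [? ?]] := close n _ _ Iz Iz' wz wz' _ Xy0; exists y'.
  by exists y'; [exact/XP|apply/esym/residue_eq].
by apply/seteqP; split; apply: sub => //; lra.
Qed.
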